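(* Let $n,m$ be positive natural numbers not both equal to $1$. Let $K_{n,m}$ be the complete bipartite graph on $n+m$ vertices $v_1,\dots,v_{n+m}$ with vertex bipartition $V_1=\{v_1,\dots,v_n\}$, $V_2=\{v_{n+1},\dots,v_{n+m}\}$, endowed with the path metric. Then $$\wp(K_{n,m})=\log_2\left(\frac{2nm}{2nm-n-m}\right).$$
   Context: For $p\ge 0$, a metric space $(X,d)$ has $p$-negative type if for all natural numbers $k\ge 2$, all finite subsets $\{x_1,\dots,x_k\}\subset X$ and all real numbers $\alpha_1,\dots,\alpha_k$ with $\alpha_1+\cdots+\alpha_k=0$ one has $\sum_{1\le i,j\le k} d(x_i,x_j)^p\alpha_i\alpha_j\le 0$ (with the convention $d(x,x)^0=0$ when $p=0$). The supremal $p$-negative type of $(X,d)$ is $\wp(X)=\wp(X,d)=\sup\{p\ge 0 : (X,d)\text{ has }p\text{-negative type}\}\in[0,\infty]$. The path metric on a connected graph is the metric on its vertex set in which the distance between two vertices is the number of edges in a shortest path joining them. *)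

(* Defs.v *)
From HB Require Import structures.
From mathcomp Require Import all_boot all_order all_algebra.
From mathcomp Require Import all_classical all_reals all_analysis.

Set Implicit Arguments.
Unset Strict Implicit.
Unset Printing Implicit Defensive.

Import Order.TTheory GRing.Theory Num.Theory.
Local Open Scope classical_set_scope.
Local Open Scope ring_scope.

(* mathcomp-analysis has 0 `^ 0 = 1, whereas negative type uses the convention
   d(x, x)^0 = 0; hence the case distinction. For p > 0 it changes nothing. *)
Definition dist_pow (R : realType) (X : metricType R) (p : R) (x y : X) : R :=
  if x == y then 0 else mdist x y `^ p.

Definition negative_type (R : realType) (X : metricType R) (p : R) : Prop :=
  forall (k : nat) (x : 'I_k -> X) (alpha : 'I_k -> R),
    (2 <= k)%N -> injective x -> \sum_(i < k) alpha i = 0 ->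
    \sum_(i < k) \sum_(j < k) dist_pow p (x i) (x j) * alpha i * alpha j <= 0.

Definition supremal_negative_type (R : realType) (X : metricType R) : \bar R :=
  ereal_sup [set p%:E | p in [set p : R | 0 <= p /\ negative_type X p]].

Record cgraph := CGraph {
  vertex :> finType;
  edge : rel vertex;
  edge_sym : symmetric edge;
  edge_irr : irreflexive edge;
  edge_connected : forall x y, connect edge x y }.

(* s omits the starting point x, so its size k is the number of edges. *)
Definition walk (G : cgraph) (x y : G) (k : nat) : bool :=
  [exists s : k.-tuple G, path (edge (c := G)) x s && (last x s == y)].

Lemma walkP (G : cgraph) (x y : G) (k : nat) :
  reflect (exists s : seq G,
    [/\ size s = k, path (edge (c := G)) x s & last x s = y]) (walk x y k).
Proof.
apply: (iffP existsP) => [[s /andP[ps /eqP ls]]|[s [<- ps ls]]].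
  by exists s; rewrite size_tuple.
by exists (in_tuple s); rewrite ps ls eqxx.
Qed.

Lemma walk_exists (G : cgraph) (x y : G) : exists k, walk x y k.
Proof.
have /connectP[s ps ->] := edge_connected x y.
by exists (size s); apply/walkP; exists s.
Qed.

Definition graph_dist (G : cgraph) (x y : G) : nat := ex_minn (walk_exists x y).

Lemma graph_dist_le (G : cgraph) (x y : G) k :
  walk x y k -> (graph_dist x y <= k)%N.
Proof. by rewrite /graph_dist; case: ex_minnP => d _; apply. Qed.

Lemma graph_dist_walk (G : cgraph) (x y : G) : walk x y (graph_dist x y).
Proof. by rewrite /graph_dist; case: ex_minnP. Qed.

Lemma graph_distxx (G : cgraph) (x : G) : graph_dist x x = 0%N.
Proof.
by apply/eqP; rewrite -leqn0; apply/graph_dist_le/walkP; exists [::].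
Qed.

Lemma graph_dist_eq0 (G : cgraph) (x y : G) : graph_dist x y = 0%N -> x = y.
Proof.
move=> d0; have /walkP[s [ss _ <-]] := graph_dist_walk x y.
by move: ss; rewrite d0 => /size0nil ->.
Qed.

Lemma graph_dist_le_sym (G : cgraph) (x y : G) :
  (graph_dist x y <= graph_dist y x)%N.
Proof.
apply/graph_dist_le/walkP; have /walkP[s [<- ps ls]] := graph_dist_walk y x.
exists (rev (belast y s)); split; first by rewrite size_rev size_belast.
- rewrite -ls rev_path (eq_path (e' := edge (c := G))) // => a b /=.
  exact: edge_sym.
- by case: s ps ls => [|a s] //= _ _; rewrite rev_cons last_rcons.
Qed.

Lemma graph_dist_sym (G : cgraph) (x y : G) : graph_dist x y = graph_dist y x.
Proof. by apply/eqP; rewrite eqn_leq !graph_dist_le_sym. Qed.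

Lemma graph_dist_triangle (G : cgraph) (y x z : G) :
  (graph_dist x z <= graph_dist x y + graph_dist y z)%N.
Proof.
have /walkP[s [<- ps ls]] := graph_dist_walk x y.
have /walkP[t [<- pt lt]] := graph_dist_walk y z.
apply/graph_dist_le/walkP; exists (s ++ t); split; first by rewrite size_cat.
- by rewrite cat_path ps ls.
- by rewrite last_cat ls.
Qed.

(* R is a phantom parameter: it keys the metricType R instance below. *)
Definition path_space (R : realType) (G : cgraph) : Type := vertex G.

HB.instance Definition _ (R : realType) (G : cgraph) :=
  Finite.copy (path_space R G) (vertex G).

Definition path_mdist (R : realType) (G : cgraph) (x y : path_space R G) : R :=
  (graph_dist (x : G) (y : G))%:R.

Lemma path_mdistxx (R : realType) (G : cgraph) (x : path_space R G) :
  path_mdist x x = 0.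
Proof. by rewrite /path_mdist graph_distxx. Qed.

Lemma path_mdist_eq0 (R : realType) (G : cgraph) (x y : path_space R G) :
  path_mdist x y = 0 -> x = y.
Proof. by move/eqP; rewrite pnatr_eq0 => /eqP/graph_dist_eq0. Qed.

Lemma path_mdist_sym (R : realType) (G : cgraph) (x y : path_space R G) :
  path_mdist x y = path_mdist y x.
Proof. by rewrite /path_mdist graph_dist_sym. Qed.

Lemma path_mdist_triangle (R : realType) (G : cgraph) (y x z : path_space R G) :
  path_mdist x z <= path_mdist x y + path_mdist y z.
Proof. by rewrite /path_mdist -natrD ler_nat graph_dist_triangle. Qed.

HB.instance Definition _ (R : realType) (G : cgraph) :=
  isMetric.Build R (path_space R G) (@path_mdistxx R G) (@path_mdist_eq0 R G)
    (@path_mdist_sym R G) (@path_mdist_triangle R G).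

Lemma mdist_path_space (R : realType) (G : cgraph) (x y : path_space R G) :
  mdist x y = (graph_dist (x : G) (y : G))%:R.
Proof. by []. Qed.

(* Vertices are numbered from 0: V_1 = {i | i < n}, V_2 = {i | n <= i < n + m}. *)
Definition bipartite_edge (n m : nat) : rel 'I_(n + m) :=
  fun i j => (i < n)%N != (j < n)%N.

Lemma bipartite_edge_sym n m : symmetric (@bipartite_edge n m).
Proof. by move=> i j; rewrite /bipartite_edge eq_sym. Qed.

Lemma bipartite_edge_irr n m : irreflexive (@bipartite_edge n m).
Proof. by move=> i; rewrite /bipartite_edge eqxx. Qed.

Lemma bipartite_edge_connected n m : (0 < n)%N -> (0 < m)%N ->
  forall x y, connect (@bipartite_edge n m) x y.
Proof.
move=> n0 m0 x y.
have [xy|xy] := boolP (bipartite_edge x y); first exact: connect1.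
have l0 : (0 < n + m)%N by rewrite addn_gt0 n0.
have ln : (n < n + m)%N by rewrite -{1}[n]addn0 ltn_add2l.
pose z := if (x < n)%N then Ordinal ln else Ordinal l0.
have zn : (z < n)%N = ~~ (x < n)%N.
  by rewrite /z; case: ifP => _ /=; rewrite ?ltnn ?n0.
have xyn : (x < n)%N = (y < n)%N by move: xy => /negPn/eqP.
apply: (@connect_trans _ _ z); apply: connect1; rewrite /bipartite_edge zn.
  by case: (x < n)%N.
by rewrite -xyn; case: (x < n)%N.
Qed.

Definition complete_bipartite (n m : nat) (n0 : (0 < n)%N) (m0 : (0 < m)%N) :
    cgraph :=
  CGraph (@bipartite_edge_sym n m) (@bipartite_edge_irr n m)
    (bipartite_edge_connected n0 m0).

(* Main.v *)
Require Import Defs.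
From mathcomp Require Import all_boot all_order all_algebra.
From mathcomp Require Import all_classical all_reals all_analysis.
From mathcomp Require Import ring lra.

Import Order.TTheory GRing.Theory Num.Theory.

Local Open Scope ring_scope.

(** With t = 2^p, the distances to the power p in K_{n,m} are 1 across the
    bipartition and t inside each side. If the weights sum to A over V_1 and to
    -A over V_2, the quadratic form is 2 (t - 1) A^2 - t sum alpha_i^2. By
    Cauchy-Schwarz on each side sum alpha_i^2 >= A^2 (1/n + 1/m), with equality
    for weights constant on each side, so p-negative type means
    2 (t - 1) <= t (1/n + 1/m), that is t <= 2nm / (2nm - n - m). *)

Lemma graph_dist_complete_bipartite {n m : nat} (n0 : (0 < n)%N) (m0 : (0 < m)%N)
    (x y : complete_bipartite n0 m0) : x != y ->
  graph_dist x y = if (x < n)%N == (y < n)%N then 2%N else 1%N.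
Proof.
move=> xy.
have d_gt0 : (0 < graph_dist x y)%N.
  by rewrite lt0n; apply: contra xy => /eqP/graph_dist_eq0 ->.
have [sxy|sxy] := eqVneq (x < n)%N (y < n)%N; last first.
  apply/eqP; rewrite eqn_leq d_gt0 andbT; apply/graph_dist_le/walkP.
  by exists [:: y]; rewrite /= andbT.
apply/eqP; rewrite eqn_leq; apply/andP; split.
  (* Both sides are nonempty, so a vertex [z] on the opposite side exists, and [x], [z], [y] is a
     walk of length 2. *)
  have [z zP] : exists z : complete_bipartite n0 m0, (z < n)%N != (x < n)%N.
    have l0 : (0 < n + m)%N by rewrite addn_gt0 n0.
    have ln : (n < n + m)%N by rewrite -{1}[n]addn0 ltn_add2l.
    case: (x < n)%N; first by exists (Ordinal ln); rewrite /= ltnn.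
    by exists (Ordinal l0); rewrite /= n0.
  apply/graph_dist_le/walkP; exists [:: z; y]; split=> //=.
  by rewrite /bipartite_edge andbT -sxy zP eq_sym zP.
(* Distance 1 would make [x] and [y] adjacent, but edges only join opposite sides. *)
rewrite ltn_neqAle d_gt0 andbT eq_sym; apply/eqP => d1.
have /walkP[[|a [|b s]] []] := graph_dist_walk x y; rewrite d1 //= => _ + ay.
by rewrite ay /bipartite_edge sxy eqxx.
Qed.

(** Writing the power as a combination of two indicators lets sums over pairs split into full,
    diagonal and cross-side sums. *)
Lemma dist_pow_complete_bipartite (R : realType) {n m : nat} (n0 : (0 < n)%N)
    (m0 : (0 < m)%N) (p : R) (x y : path_space R (complete_bipartite n0 m0)) :
  dist_pow p x y =
    2 `^ p * (x != y)%:R - (2 `^ p - 1) * ((val x < n)%N != (val y < n)%N)%:R.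
Proof.
rewrite /dist_pow; have [->|xy] := eqVneq x y; first by rewrite eqxx !mulr0 subr0.
rewrite mdist_path_space graph_dist_complete_bipartite //.
by case: eqVneq => _ /=; rewrite ?powR1; ring.
Qed.

Lemma sum_predC_opp (V : zmodType) (I : finType) (P : pred I) (f : I -> V) :
  \sum_i f i = 0 -> \sum_(i | ~~ P i) f i = - \sum_(i | P i) f i.
Proof. by rewrite (bigID P) /= addrC => /eqP; rewrite addr_eq0 => /eqP. Qed.

(** Since the weights sum to zero, the full sum in each row vanishes and only its diagonal and
    cross-side parts remain; the latter is [A] or [- A] according to the side of [x i]. *)
Lemma quadratic_form_complete_bipartite {R : realType} {n m : nat}
    (n0 : (0 < n)%N) (m0 : (0 < m)%N) (p : R) {k : nat}
    (x : 'I_k -> path_space R (complete_bipartite n0 m0)) (alpha : 'I_k -> R) :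
  injective x -> \sum_(i < k) alpha i = 0 ->
  \sum_(i < k) \sum_(j < k) dist_pow p (x i) (x j) * alpha i * alpha j =
    2 * (2 `^ p - 1) * (\sum_(i < k | (val (x i) < n)%N) alpha i) ^+ 2 -
    2 `^ p * \sum_(i < k) alpha i ^+ 2.
Proof.
move=> xinj sum0; set A := \sum_(i < k | (val (x i) < n)%N) alpha i.
have AC : \sum_(i < k | ~~ (val (x i) < n)%N) alpha i = - A.
  exact: (sum_predC_opp _ _ (fun i => (val (x i) < n)%N) _ sum0).
have row (i : 'I_k) : \sum_(j < k) dist_pow p (x i) (x j) * alpha i * alpha j =
    (2 `^ p - 1) * (if (val (x i) < n)%N then alpha i * A else - (alpha i * A))
    - 2 `^ p * alpha i ^+ 2.
  transitivity (\sum_(j < k) (2 `^ p * alpha i * alpha j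
      - 2 `^ p * alpha i * (if j == i then alpha j else 0)
      - (2 `^ p - 1) * alpha i *
        (if (val (x i) < n)%N != (val (x j) < n)%N then alpha j else 0))).
    apply: eq_bigr => j _; rewrite dist_pow_complete_bipartite (inj_eq xinj) eq_sym.
    by case: (j == i); case: (_ != _ :> bool) => /=; ring.
  rewrite !sumrB -!mulr_sumr sum0 -!big_mkcond /= big_pred1_eq.
  have -> : \sum_(j < k | (val (x i) < n)%N != (val (x j) < n)%N) alpha j =
      if (val (x i) < n)%N then - A else A.
    by case: (val (x i) < n)%N; rewrite -?AC; apply: eq_bigl => j;
       case: (val (x j) < n)%N.
  by case: ifP => _; ring.
rewrite (eq_bigr _ (fun i _ => row i)) sumrB -!mulr_sumr; congr (_ - _).
(* Each side contributes [A ^+ 2]: the sign of the row on V_2 cancels that of its total weight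
   [- A]. *)
rewrite (bigID (fun i => (val (x i) < n)%N)) /=.
rewrite (eq_bigr (fun i => alpha i * A)); last by move=> i ->.
rewrite [X in _ * (_ + X)](eq_bigr (fun i => - (alpha i * A))); last first.
  by move=> i /negbTE ->.
by rewrite sumrN -!mulr_suml AC -/A; ring.
Qed.

(** Expand the nonnegative sum of squared deviations from [S / N%:R]. Only a bound [N] on the
    cardinal is asked for, because a finite subset may miss some vertices of a side. *)
Lemma sqr_sum_le_card (R : realType) (I : finType) (P : pred I) (f : I -> R)
    (N : nat) : (0 < N)%N -> (#|P| <= N)%N ->
  (\sum_(i | P i) f i) ^+ 2 / N%:R <= \sum_(i | P i) f i ^+ 2.
Proof.
move=> N0 PN; set S := \sum_(i | P i) f i.
have N0' : 0 < N%:R :> R by rewrite ltr0n.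
have : 0 <= \sum_(i | P i) (f i - S / N%:R) ^+ 2.
  by apply: sumr_ge0 => i _; exact: sqr_ge0.
have -> : \sum_(i | P i) (f i - S / N%:R) ^+ 2 =
    \sum_(i | P i) f i ^+ 2 - 2 * S ^+ 2 / N%:R + (S / N%:R) ^+ 2 * #|P|%:R.
  transitivity (\sum_(i | P i)
      (f i ^+ 2 - f i * (2 * S / N%:R) + (S / N%:R) ^+ 2)).
    by apply: eq_bigr => i _; ring.
  rewrite big_split sumrB -mulr_suml -/S /= sumr_const mulr_natr.
  by congr (_ - _ + _); ring.
have : (S / N%:R) ^+ 2 * #|P|%:R <= (S / N%:R) ^+ 2 * N%:R.
  by rewrite ler_wpM2l ?sqr_ge0 // ler_nat.
have -> : (S / N%:R) ^+ 2 * N%:R = S ^+ 2 / N%:R by field; rewrite lt0r_neq0.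
lra.
Qed.

Lemma sum_const_on_sides {R : realType} (n m : nat) (a b : R) :
  \sum_(i < n + m) (if (i < n)%N then a else b) = a * n%:R + b * m%:R.
Proof.
rewrite big_split_ord /=.
under eq_bigr do rewrite ltn_ord.
under [X in _ + X]eq_bigr do rewrite ltnNge leq_addr /=.
by rewrite !sumr_const !card_ord !mulr_natr.
Qed.

Lemma negative_type_complete_bipartite (R : realType) {n m : nat}
    (n0 : (0 < n)%N) (m0 : (0 < m)%N) (p : R) : 0 <= p ->
  negative_type (path_space R (complete_bipartite n0 m0)) p <->
  2 * (2 `^ p - 1) <= 2 `^ p * (n%:R^-1 + m%:R^-1).
Proof.
move=> p0; set t : R := 2 `^ p.
have t1 : 1 <= t by rewrite -(powRr0 2) ler_powR // ler1n.
have n0' : 0 < n%:R :> R by rewrite ltr0n.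
have m0' : 0 < m%:R :> R by rewrite ltr0n.
split=> [neg|tle k x alpha _ xinj sum0].
  (* Equality case of Cauchy-Schwarz on the whole vertex set: weights constant on each side, with
     totals 1 and -1, so that [A] is 1. *)
  pose alpha (i : 'I_(n + m)) : R := if (i < n)%N then n%:R^-1 else - m%:R^-1.
  have sum0 : \sum_i alpha i = 0.
    by rewrite sum_const_on_sides; field; rewrite !lt0r_neq0.
  have nm2 : (2 <= n + m)%N by rewrite (leq_add n0 m0).
  have := neg _ (id : 'I_(n + m) -> path_space R (complete_bipartite n0 m0))
    alpha nm2 (@inj_id _) sum0.
  rewrite quadratic_form_complete_bipartite // -/t.
  have -> : \sum_(i < n + m | (i < n)%N) alpha i = 1.
    transitivity (\sum_(i < n + m) (if (i < n)%N then n%:R^-1 else 0 : R)).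
      by rewrite -big_mkcond; apply: eq_bigr => i; rewrite /alpha => ->.
    by rewrite sum_const_on_sides mul0r addr0 mulVf // lt0r_neq0.
  have -> : \sum_(i < n + m) alpha i ^+ 2 = n%:R^-1 + m%:R^-1.
    transitivity (\sum_(i < n + m)
        (if (i < n)%N then n%:R^-1 ^+ 2 else (- m%:R^-1) ^+ 2 : R)).
      by apply: eq_bigr => i _; rewrite /alpha; case: ifP.
    by rewrite sum_const_on_sides; field; rewrite !lt0r_neq0.
  by rewrite expr1n mulr1 subr_le0.
rewrite quadratic_form_complete_bipartite // -/t subr_le0.
set A := \sum_(i < k | _) _.
(* The points are distinct, so their labels are distinct elements of [iota 0 n] on V_1 and of
   [iota n m] on V_2, which bounds the number of points on each side. *)
have valx_inj : injective (fun i => val (x i)) by move=> i j /val_inj/xinj.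
have side1 : (#|[pred i | (val (x i) < n)%N]| <= n)%N.
  rewrite cardE -[X in (_ <= X)%N](size_iota 0 n) -(size_map (fun i => val (x i))).
  apply: uniq_leq_size; first by rewrite map_inj_uniq ?enum_uniq.
  by move=> _ /mapP[i + ->]; rewrite mem_enum inE mem_iota.
have side2 : (#|[pred i | ~~ (val (x i) < n)%N]| <= m)%N.
  rewrite cardE -[X in (_ <= X)%N](size_iota n m) -(size_map (fun i => val (x i))).
  apply: uniq_leq_size; first by rewrite map_inj_uniq ?enum_uniq.
  move=> _ /mapP[i + ->]; rewrite mem_enum inE mem_iota -leqNgt => -> /=.
  exact: ltn_ord.
have := sqr_sum_le_card _ _ _ alpha _ m0 side2.
have -> : \sum_(i < k | ~~ (val (x i) < n)%N) alpha i = - A.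
  exact: (sum_predC_opp _ _ (fun i => (val (x i) < n)%N) _ sum0).
rewrite sqrrN => le2.
have le1 := sqr_sum_le_card _ _ _ alpha _ n0 side1.
apply: (@le_trans _ _ (t * (n%:R^-1 + m%:R^-1) * A ^+ 2)).
  by rewrite ler_wpM2r // sqr_ge0.
rewrite -mulrA ler_wpM2l ?(le_trans _ t1) //.
rewrite [leRHS](bigID (fun i => (val (x i) < n)%N)) /=.
by rewrite mulrDl ![_^-1 * _]mulrC lerD.
Qed.

Theorem theorem3p1 (R : realType) (n m : nat) (n0 : (0 < n)%N) (m0 : (0 < m)%N)
    (nm : ~ (n = 1%N /\ m = 1%N)) :
  supremal_negative_type (path_space R (complete_bipartite n0 m0)) =
  (ln ((2 * n%:R * m%:R) / (2 * n%:R * m%:R - n%:R - m%:R)) / ln 2)%:E.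
Proof.
have n1 : 1 <= n%:R :> R by rewrite ler1n.
have m1 : 1 <= m%:R :> R by rewrite ler1n.
(* The denominator equals n (m - 1) + m (n - 1), which is positive once n or m is at least 2. *)
have D0 : 0 < 2 * n%:R * m%:R - n%:R - m%:R :> R.
  have [n2|n2] := leqP 2 n.
    have : 2 <= n%:R :> R by rewrite ler_nat.
    nra.
  have m2 : (2 <= m)%N.
    rewrite ltnNge; apply/negP => m1'; apply: nm.
    by split; apply/anti_leq; rewrite ?n0 ?m0 ?m1' ?andbT.
  have : 2 <= m%:R :> R by rewrite ler_nat.
  nra.
set D := (X in 0 < X) in D0 *; set r := _ / D.
have r1 : 1 <= r by rewrite /r ler_pdivlMr // mul1r /D; lra.
have ln2 : 0 < ln 2 :> R by rewrite ln_gt0 // ltr1n.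
have negP (p : R) : 0 <= p ->
    negative_type (path_space R (complete_bipartite n0 m0)) p <-> p <= ln r / ln 2.
  move=> p0; apply: (iff_trans (negative_type_complete_bipartite _ n0 m0 _ p0)).
  rewrite ler_pdivlMr // -ln_powR ler_ln ?posrE ?powR_gt0 ?(lt_le_trans ltr01 r1) //.
  rewrite /r ler_pdivlMr //.
  have -> : n%:R^-1 + m%:R^-1 = (n%:R + m%:R) / (n%:R * m%:R) :> R.
    by field; rewrite !pnatr_eq0 -!lt0n n0 m0.
  rewrite mulrA ler_pdivlMr ?mulr_gt0 ?ltr0n // /D.
  by split=> h; lra.
have c0 : 0 <= ln r / ln 2 by rewrite divr_ge0 ?(ltW ln2) ?ln_ge0.
apply/eqP; rewrite eq_le; apply/andP; split.
  by apply: ge_ereal_sup => _ [p [p0 /(negP _ p0) pc] <-]; rewrite lee_fin.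
(* The supremum is attained: the nonnegative exponent [ln r / ln 2] itself satisfies the
   criterion. *)
apply: ereal_sup_ubound; exists (ln r / ln 2) => //; split=> //.
exact/negP.
Qed.
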